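(* Let $T=(T_n)_{n\in\mathbb N}$ be an approximately geometric sequence in the semiring of tensors. Then the sequence is almost exponential. Moreover, for every adequate $F$ the limit \[\lim_{n\to\infty}\sqrt[n]{F(T_n)}\] exists, and is equal to $\lim_{n\to\infty}\sqrt[n]{\underset{\sim}{F}(T_n)}$.
   Context: Semiring of tensors: a tensor is an element of $V_1\otimes V_2\otimes V_3$ with $V_j$ finite-dimensional complex vector spaces. A tensor $s\in V_1\otimes V_2\otimes V_3$ restricts to $t\in W_1\otimes W_2\otimes W_3$, written $t\le s$, if $t=(A_1\otimes A_2\otimes A_3)s$ for some linear maps $A_j:V_j\to W_j$; $s,t$ are equivalent if each restricts to the other. The set of equivalence classes of tensors, with direct sum $\oplus$ as addition, Kronecker (tensor) product $\otimes$ as multiplication and the preorder $\le$, is a preordered semiring. Natural numbers $r$ correspond to unit tensors $\langle r\rangle=\sum_{i=1}^re_i\otimes e_i\otimes e_i$. The matrix multiplication tensors are $\langle l,m,n\rangle=\sum_{i=1}^l\sum_{j=1}^m\sum_{k=1}^ne_{(i,j)}\otimes e_{(j,k)}\otimes e_{(k,i)}$. The tensor rank is $R(t)=\min\{r\in\mathbb N:t\le\langle r\rangle\}$ and the asymptotic rank is $\underset{\sim}{R}(t)=\lim_{n\to\infty}\sqrt[n]{R(t^{\otimes n})}$. Approximately geometric sequences: $\mathbb N$ includes $0$; a sublinear sequence is a sequence $(k_n)_{n\in\mathbb N}$ in $\mathbb N$ with $k_n/n\to0$. Sequences of tensors satisfy $a\approx b$ if for some sublinear $(k_n)$ one has $a_n\le\langle2\rangle^{\otimes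 k_n}\otimes b_n$ and $b_n\le\langle 2\rangle^{\otimes k_n}\otimes a_n$ for all $n$. A sequence $(T_n)_{n\in\mathbb N}$ is approximately geometric if either $T\approx(1,0,0,\dots)$, or all $T_n$ are nonzero and there is a sublinear sequence $(k_n)$ such that for all $t\in\mathbb N_{>0}$ and $n_1,\dots,n_t\in\mathbb N$ both $T_{n_1}\otimes\cdots\otimes T_{n_t}\le\langle2\rangle^{\otimes(k_{n_1}+\dots+k_{n_t})}\otimes T_{n_1+\dots+n_t}$ and $T_{n_1+\dots+n_t}\le\langle2\rangle^{\otimes(k_{n_1}+\dots+k_{n_t})}\otimes T_{n_1}\otimes\cdots\otimes T_{n_t}$ hold. A functional $F$ from (equivalence classes of) tensors to $\mathbb R_{\ge0}$ is adequate if it is monotone under $\le$, submultiplicative under $\otimes$, multiplicative on matrix multiplication tensors (with respect to $\otimes$), satisfies $F(\langle r\rangle\otimes T)=rF(T)$ for all $r\in\mathbb N$ and tensors $T$, and $F\le\underset{\sim}{R}$. For adequate $F$, $\underset{\sim}{F}(T)=\lim_{n\to\infty}\sqrt[n]{F(T^{\otimes n})}$ (the limit exists and $\underset{\sim}{F}$ is adequate). A sequence of tensors $T_0,T_1,T_2,\dots$ is almost exponential if the sequence $\sqrt[n]{\underset{\sim}{R}(T_n)}$ converges and $\sqrt[n]{F(T_n)}$ is bounded for each adequate $F$. *)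

(* Defs.v *)
From HB Require Import structures.
From mathcomp Require Import all_boot all_order all_algebra.
From mathcomp Require Import complex.
From mathcomp Require Import all_classical all_reals all_analysis.

Set Implicit Arguments.
Unset Strict Implicit.
Unset Printing Implicit Defensive.

Import Order.TTheory GRing.Theory Num.Theory.
Import numFieldNormedType.Exports.

Local Open Scope classical_set_scope.
Local Open Scope ring_scope.

(* An element of V1 (x) V2 (x) V3 given by its coordinates in chosen bases:
   V_j is C^(I_j) for a finite index type I_j, with C = R[i].  A tensor here
   is a representative of its equivalence class; the notions below only depend
   on the classes. *)
Record tensor (R : realType) := Tensor {
  idx1 : finType;
  idx2 : finType;
  idx3 : finType;
  coef : idx1 -> idx2 -> idx3 -> R[i] }.

Arguments Tensor {R idx1 idx2 idx3} coef.
Arguments coef {R} t _ _ _ : rename.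

(* t <= s : t = (A1 (x) A2 (x) A3) s for linear maps A_j, given by matrices *)
Definition tle (R : realType) (t s : tensor R) : Prop :=
  exists (A1 : idx1 t -> idx1 s -> R[i])
         (A2 : idx2 t -> idx2 s -> R[i])
         (A3 : idx3 t -> idx3 s -> R[i]),
    forall i j k,
      coef t i j k =
      \sum_(a : idx1 s) \sum_(b : idx2 s) \sum_(c : idx3 s)
         A1 i a * A2 j b * A3 k c * coef s a b c.

Definition tequiv (R : realType) (s t : tensor R) : Prop := tle s t /\ tle t s.

Definition kron (R : realType) (s t : tensor R) : tensor R :=
  Tensor (fun (i : idx1 s * idx1 t) (j : idx2 s * idx2 t)
              (k : idx3 s * idx3 t) =>
    coef s i.1 j.1 k.1 * coef t i.2 j.2 k.2).

Definition unit_tensor (R : realType) (r : nat) : tensor R :=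
  Tensor (fun i j k : 'I_r => ((i == j) && (j == k))%:R).

Arguments unit_tensor R r : clear implicits.

Definition tpow (R : realType) (t : tensor R) (n : nat) : tensor R :=
  iter n (kron t) (unit_tensor R 1%N).

Definition mm_tensor (R : realType) (l m n : nat) : tensor R :=
  Tensor (fun (p : 'I_l * 'I_m) (q : 'I_m * 'I_n) (r : 'I_n * 'I_l) =>
    \sum_(i < l) \sum_(j < m) \sum_(k < n)
      [&& p == (i, j), q == (j, k) & r == (k, i)]%:R).

Arguments mm_tensor R l m n : clear implicits.

Lemma tle_unit_ex (R : realType) (t : tensor R) :
  exists r : nat, `[< tle t (unit_tensor R r) >].
Proof.
case: t => I J K f.
exists #|{: I * J * K}|; apply/asboolP.
exists (fun i a => (i == (enum_val a).1.1)%:R).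
exists (fun j a => (j == (enum_val a).1.2)%:R).
exists (fun k a => (k == (enum_val a).2)%:R *
   f (enum_val a).1.1 (enum_val a).1.2 (enum_val a).2) => i j k /=.
pose a0 := enum_rank (i, j, k).
rewrite (bigD1 a0) //= [X in _ + X]big1 ?addr0; last first.
  move=> a ne; rewrite big1 // => b _; rewrite big1 // => c _.
  case: (a =P b) => [<-|_]; last by rewrite mulr0.
  case: (a =P c) => [<-|_]; last by rewrite mulr0.
  rewrite mulr1 mulrA -!natrM !mulnb -andbA -!xpair_eqE.
  case: eqP => [e|_]; last by rewrite mul0r.
  case/eqP: ne; rewrite /a0.
  have -> : (i, j, k) = enum_val a.
    by move: e; case: (enum_val a) => [[x y] z] /= [-> -> ->].
  by rewrite enum_valK.
rewrite (bigD1 a0) //= [X in _ + X]big1 ?addr0; last first.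
  move=> b ne; rewrite big1 // => c _.
  by rewrite [a0 == b]eq_sym (negPf ne) mulr0.
rewrite (bigD1 a0) //= [X in _ + X]big1 ?addr0; last first.
  by move=> c ne; rewrite [a0 == c]eq_sym (negPf ne) andbF mulr0.
by rewrite /a0 enum_rankK /= !eqxx !mul1r mulr1.
Qed.

Definition rank (R : realType) (t : tensor R) : nat := ex_minn (tle_unit_ex t).

(* For n = 0 the value is x `^ 0 = 1, which affects neither limits nor
   boundedness of sequences. *)
Definition nroot (R : realType) (n : nat) (x : R) : R := x `^ (n%:R^-1).

Definition asym_rank (R : realType) (t : tensor R) : R :=
  limn (fun n => nroot n (rank (tpow t n))%:R).

Definition sublinear (R : realType) (k : nat -> nat) : Prop :=
  (fun n => (k n)%:R / n%:R : R) @ \oo --> (0 : R).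

Arguments sublinear R k : clear implicits.

Definition approx (R : realType) (a b : nat -> tensor R) : Prop :=
  exists k : nat -> nat, sublinear R k /\
    forall n,
      tle (a n) (kron (tpow (unit_tensor R 2%N) (k n)) (b n)) /\
      tle (b n) (kron (tpow (unit_tensor R 2%N) (k n)) (a n)).

Definition approx_geometric (R : realType) (T : nat -> tensor R) : Prop :=
  approx T (fun n => unit_tensor R (if n is 0%N then 1%N else 0%N)) \/
  ((forall n, ~ tequiv (T n) (unit_tensor R 0%N)) /\
   exists k : nat -> nat, sublinear R k /\
     forall (t : nat) (n : 'I_t -> nat), (0 < t)%N ->
       let P := \big[@kron R/unit_tensor R 1%N]_(i < t) T (n i) in
       let S := T (\sum_(i < t) n i)%N in
       let E := tpow (unit_tensor R 2%N) (\sum_(i < t) k (n i))%N in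
       tle P (kron E S) /\ tle S (kron E P)).

(* Monotonicity makes F constant on equivalence classes. *)
Record adequate (R : realType) (F : tensor R -> R) : Prop := Adequate {
  adequate_ge0 : forall t, 0 <= F t;
  adequate_mono : forall s t, tle s t -> F s <= F t;
  adequate_submul : forall s t, F (kron s t) <= F s * F t;
  adequate_mm : forall l m n l' m' n',
    F (kron (mm_tensor R l m n) (mm_tensor R l' m' n')) =
    F (mm_tensor R l m n) * F (mm_tensor R l' m' n');
  adequate_unit : forall r t, F (kron (unit_tensor R r) t) = r%:R * F t;
  adequate_le_asym_rank : forall t, F t <= asym_rank t }.

Definition asym (R : realType) (F : tensor R -> R) (t : tensor R) : R :=
  limn (fun n => nroot n (F (tpow t n))).

Definition almost_exponential (R : realType) (T : nat -> tensor R) : Prop :=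
  cvgn (fun n => nroot n (asym_rank (T n))) /\
  forall F : tensor R -> R, adequate F ->
    bounded_fun (fun n => nroot n (F (T n)) : R).

(* Main.v *)
(* Approximate geometricity turns g(N) = G(T_N) into an almost submultiplicative
   sequence, g(qn + r) <= C (2^(k_n) g(n))^q 2^(k_r) g(r), for any monotone
   submultiplicative G with G(<2> (x) t) <= 2 G(t), so Fekete's argument gives
   a limit L of g(N)^(1/N).  The tensor powers T_n = t^(x)n of a single t are
   the special case k = 0.  Comparing T_n^(x)m with T_(mn) up to a factor
   2^(m k_n) and letting m tend to infinity bounds the regularization of G at
   T_n between 2^(-k_n) L^n and 2^(k_n) L^n, and its n-th root converges to L
   as well.  Since the asymptotic rank is by definition the regularization of
   the rank, G = R(-) gives the statement on asymptotic rank without proving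
   that the asymptotic rank is itself adequate. *)
Require Import Defs.
From mathcomp Require Import all_boot all_order all_algebra.
From mathcomp Require Import complex ring.
From mathcomp Require Import all_classical all_reals all_analysis.

Set Implicit Arguments.
Unset Strict Implicit.
Unset Printing Implicit Defensive.

Import Order.TTheory GRing.Theory Num.Theory.
Import numFieldNormedType.Exports.
Local Open Scope classical_set_scope.
Local Open Scope ring_scope.

(** * Restriction of tensors and Kronecker products *)

Lemma sum_prod3 (K : comPzRingType) (I J L : finType)
    (f : I -> K) (g : J -> K) (h : L -> K) :
  \sum_i \sum_j \sum_l f i * g j * h l =
  (\sum_i f i) * (\sum_j g j) * (\sum_l h l).
Proof.
rewrite [in RHS]big_distrlr /= mulr_suml; apply: eq_bigr => i _.
by rewrite mulr_suml; apply: eq_bigr => j _; rewrite mulr_sumr.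
Qed.

(** The three matrices are 0-1 matrices with a single 1 in each row. This covers every restriction
    that only selects or relabels coordinates, such as the unit and associativity laws below. *)
Lemma tle_reindex (R : realType) (s t : tensor R)
    (f1 : idx1 t -> idx1 s) (f2 : idx2 t -> idx2 s) (f3 : idx3 t -> idx3 s) :
  (forall i j k, coef t i j k = coef s (f1 i) (f2 j) (f3 k)) -> tle t s.
Proof.
move=> h; exists (fun i a => (a == f1 i)%:R), (fun i a => (a == f2 i)%:R),
  (fun i a => (a == f3 i)%:R) => i j k.
rewrite h (bigD1 (f1 i)) //= [X in _ + X]big1 ?addr0; last first.
  by move=> a /negPf ->; rewrite big1 // => b _; rewrite big1 // => c _; rewrite !mul0r.
rewrite (bigD1 (f2 j)) //= [X in _ + X]big1 ?addr0; last first.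
  by move=> b /negPf ->; rewrite big1 // => c _; rewrite mulr0 !mul0r.
rewrite (bigD1 (f3 k)) //= [X in _ + X]big1 ?addr0; last first.
  by move=> c /negPf ->; rewrite mulr0 !mul0r.
by rewrite !eqxx !mul1r.
Qed.

Lemma tle_refl (R : realType) (t : tensor R) : tle t t.
Proof. exact: (@tle_reindex R t t id id id). Qed.

Lemma tle_trans (R : realType) (s t u : tensor R) :
  tle t s -> tle s u -> tle t u.
Proof.
move=> [A1 [A2 [A3 hA]]] [B1 [B2 [B3 hB]]].
exists (fun i a => \sum_x A1 i x * B1 x a), (fun i a => \sum_x A2 i x * B2 x a),
  (fun i a => \sum_x A3 i x * B3 x a) => i j k.
(* Summand over index triples [p] of [s] and [q] of [u]; the claim is the exchange of these two
   sums. *)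
pose G p (q : idx1 u * idx2 u * idx3 u) := A1 i p.1.1 * A2 j p.1.2 * A3 k p.2 *
  (B1 p.1.1 q.1.1 * B2 p.1.2 q.1.2 * B3 p.2 q.2 * coef u q.1.1 q.1.2 q.2).
transitivity (\sum_p \sum_q G p q).
  rewrite hA [LHS]pair_bigA /= [LHS]pair_bigA /=; apply: eq_bigr => p _.
  rewrite hB [X in _ * X]pair_bigA /= [X in _ * X]pair_bigA /= mulr_sumr.
  by apply: eq_bigr => q _.
rewrite exchange_big /= [RHS]pair_bigA /= [RHS]pair_bigA /=; apply: eq_bigr => q _.
rewrite -sum_prod3 [X in X * _]pair_bigA /= [X in X * _]pair_bigA /= mulr_suml.
by apply: eq_bigr => p _; rewrite /G; ring.
Qed.

Lemma kron_tle (R : realType) (s s' t t' : tensor R) :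
  tle s s' -> tle t t' -> tle (kron s t) (kron s' t').
Proof.
move=> [A1 [A2 [A3 hA]]] [B1 [B2 [B3 hB]]].
exists (fun i a => A1 i.1 a.1 * B1 i.2 a.2), (fun i a => A2 i.1 a.1 * B2 i.2 a.2),
  (fun i a => A3 i.1 a.1 * B3 i.2 a.2) => -[i i'] [j j'] [k k'] /=.
rewrite hA hB.
rewrite pair_bigA /= pair_bigA /= [X in _ * X]pair_bigA /= [X in _ * X]pair_bigA /=.
rewrite [RHS]pair_bigA /= [RHS]pair_bigA /= big_distrlr /= [LHS]pair_bigA /=.
(* [f] regroups three pairs of indices into two triples, so that the sum over the product index sets
   becomes the product of two triple sums. *)
pose f (p : (idx1 s' * idx1 t') * (idx2 s' * idx2 t') * (idx3 s' * idx3 t')) :=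
  ((p.1.1.1, p.1.2.1, p.2.1), (p.1.1.2, p.1.2.2, p.2.2)).
rewrite (reindex f) /=; first by apply: eq_bigr => p _; rewrite /f /=; ring.
exists (fun q : (idx1 s' * idx2 s' * idx3 s') * (idx1 t' * idx2 t' * idx3 t') =>
  ((q.1.1.1, q.2.1.1), (q.1.1.2, q.2.1.2), (q.1.2, q.2.2))).
- by move=> [[[? ?] [? ?]] [? ?]] _.
- by move=> [[[? ?] ?] [[? ?] ?]] _.
Qed.

Lemma kron1_tge (R : realType) (t : tensor R) : tle t (kron (unit_tensor R 1) t).
Proof.
apply: (@tle_reindex R (kron (unit_tensor R 1) t) t
  (pair ord0) (pair ord0) (pair ord0)) => i j k /=.
by rewrite mul1r.
Qed.

Lemma kronA_tle (R : realType) (s t u : tensor R) :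
  tle (kron s (kron t u)) (kron (kron s t) u).
Proof.
apply: (@tle_reindex R (kron (kron s t) u) (kron s (kron t u))
  (fun i => ((i.1, i.2.1), i.2.2)) (fun i => ((i.1, i.2.1), i.2.2))
  (fun i => ((i.1, i.2.1), i.2.2))) => i j k /=.
by rewrite mulrA.
Qed.

Lemma tpowD_tle (R : realType) (t : tensor R) a b :
  tle (tpow t (a + b)) (kron (tpow t a) (tpow t b)).
Proof.
elim: a => [|a IH]; first exact: kron1_tge.
apply: (tle_trans (kron_tle (tle_refl t) IH)); exact: kronA_tle.
Qed.

Lemma unit_tensorM_tle (R : realType) r q :
  tle (kron (unit_tensor R r) (unit_tensor R q)) (unit_tensor R (r * q)).
Proof.
apply: (@tle_reindex R (unit_tensor R (r * q)) (kron (unit_tensor R r) (unit_tensor R q))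
  (fun i => mxvec_index i.1 i.2) (fun i => mxvec_index i.1 i.2)
  (fun i => mxvec_index i.1 i.2)) => -[i i'] [j j'] [k k'] /=.
(* [mxvec_index] numbers pairs by elements of ['I_(r * q)]; by injectivity the diagonal there
   corresponds to the product of the two diagonals. *)
have E (x y : 'I_r) (x' y' : 'I_q) :
    (mxvec_index x x' == mxvec_index y y') = (x == y) && (x' == y').
  apply/idP/andP => [|[/eqP-> /eqP->//]].
  move=> /eqP/(can_inj (cast_ordK _))/enum_rank_inj [-> ->].
  by rewrite !eqxx.
rewrite !E -natrM mulnb; congr (_ : bool)%:R.
by case: (i == j); case: (j == k); case: (i' == j').
Qed.

(** * Tensor rank *)

Lemma rankP (R : realType) (t : tensor R) : tle t (unit_tensor R (rank t)).
Proof. by rewrite /rank; case: ex_minnP => r /asboolP. Qed.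

Lemma rank_min (R : realType) (t : tensor R) r :
  tle t (unit_tensor R r) -> (rank t <= r)%N.
Proof. by move=> h; rewrite /rank; case: ex_minnP => m _; apply; apply/asboolP. Qed.

Lemma rank_mono (R : realType) (s t : tensor R) : tle s t -> (rank s <= rank t)%N.
Proof. by move=> h; apply/rank_min/(tle_trans h)/rankP. Qed.

Lemma rank_submul (R : realType) (s t : tensor R) :
  (rank (kron s t) <= rank s * rank t)%N.
Proof.
apply/rank_min/(tle_trans (kron_tle (rankP s) (rankP t)))/unit_tensorM_tle.
Qed.

Lemma rank_unit_le (R : realType) r : (rank (unit_tensor R r) <= r)%N.
Proof. exact/rank_min/tle_refl. Qed.

(** * Roots, sublinear exponents and Fekete's lemma *)

Lemma nroot_ge0 (R : realType) n (x : R) : 0 <= nroot n x.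
Proof. exact: powR_ge0. Qed.

Lemma nrootM (R : realType) n (x y : R) :
  0 <= x -> 0 <= y -> nroot n (x * y) = nroot n x * nroot n y.
Proof. exact: powRM. Qed.

Lemma ler_nroot (R : realType) n (x y : R) :
  0 <= x -> x <= y -> nroot n x <= nroot n y.
Proof.
move=> x0 xy; apply: ge0_ler_powR => //; rewrite ?nnegrE ?invr_ge0 //.
exact: le_trans xy.
Qed.

Lemma exprn_nroot (R : realType) n (x : R) :
  (0 < n)%N -> 0 <= x -> nroot n x ^+ n = x.
Proof.
move=> n0 x0; rewrite -powR_mulrn ?powR_ge0 // -powRrM mulVf ?powRr1 //.
by rewrite pnatr_eq0 -lt0n.
Qed.

Lemma nroot_exprn (R : realType) n (x : R) :
  (0 < n)%N -> 0 <= x -> nroot n (x ^+ n) = x.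
Proof.
move=> n0 x0; rewrite /nroot -powR_mulrn // -powRrM mulfV ?powRr1 //.
by rewrite pnatr_eq0 -lt0n.
Qed.

Lemma nroot_exprM (R : realType) n m (x : R) :
  (0 < n)%N -> (0 < m)%N -> 0 <= x -> nroot m x = nroot (m * n) x ^+ n.
Proof.
move=> n0 m0 x0; rewrite -[in LHS](@exprn_nroot R (m * n) x) ?muln_gt0 ?m0 //.
by rewrite mulnC exprM nroot_exprn // exprn_ge0 ?nroot_ge0.
Qed.

Lemma nroot0 (R : realType) n : (0 < n)%N -> nroot n 0 = 0 :> R.
Proof. by move=> n0; rewrite /nroot powR0 // invr_eq0 pnatr_eq0 -lt0n. Qed.

Lemma cvg_expRM_div (R : realType) (a : R) (k : nat -> R) :
  (fun n => k n / n%:R) @ \oo --> (0 : R) ->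
  (fun n => expR (k n / n%:R * a)) @ \oo --> (1 : R).
Proof.
move=> h; rewrite -[X in _ --> X]expR0.
apply: continuous_cvg; first exact: continuous_expR.
by rewrite -[X in _ --> X](mul0r a); apply: cvgM => //; exact: cvg_cst.
Qed.

(** The root equals [exp((k_n / n) ln a)] and the exponent tends to 0. Hence error factors [2^(k_n)]
    disappear under n-th roots. *)
Lemma cvg_nroot_exprn (R : realType) (k : nat -> nat) (a : R) : 0 < a ->
  sublinear R k -> (fun n => nroot n (a ^+ k n)) @ \oo --> (1 : R).
Proof.
move=> a0 /(cvg_expRM_div (ln a)); apply: cvg_trans; apply: near_eq_cvg.
apply: nearW => n /=.
by rewrite /nroot -powR_mulrn ?ltW // -powRrM /powR gt_eqF.
Qed.

Lemma cvg_nroot_cst (R : realType) (a : R) : 0 < a ->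
  (fun n => nroot n a) @ \oo --> (1 : R).
Proof.
move=> a0; apply: (@cvg_nroot_exprn R (fun=> 1%N)) => //.
rewrite /sublinear; under eq_fun do rewrite mul1r.
apply/gtr0_cvgV0; last exact: cvgr_idn.
by near=> n; rewrite ltr0n; near: n; exact: nbhs_infty_gt.
Unshelve. all: end_near. Qed.

Lemma sublinear0 (R : realType) : sublinear R (fun=> 0%N).
Proof. by rewrite /sublinear; under eq_fun do rewrite mul0r; exact: cvg_cst. Qed.

(** Multiplicative Fekete lemma with subexponential errors. The limit is the infimum of [x n], the
    n-th root of [2^(k_n) g(n)]: no [x N] with [N > 0] is below it, and division of [N] by one [n]
    with [x n] near the infimum bounds [x N] from above. *)
Lemma fekete (R : realType) (g : nat -> R) (k : nat -> nat) (C : R) :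
  0 < C -> (forall n, 0 <= g n) -> sublinear R k ->
  (forall n q r,
     g (q * n + r)%N <= C * (2 ^+ k n * g n) ^+ q * (2 ^+ k r * g r)) ->
  cvgn (fun n => nroot n (g n)).
Proof.
move=> C0 g0 ksub hg.
pose h n := 2 ^+ k n * g n.
have h0 n : 0 <= h n by rewrite mulr_ge0 ?exprn_ge0.
pose c n : R := nroot n (2 ^+ k n).
have c1 : c @ \oo --> (1 : R) by exact: cvg_nroot_exprn.
pose x n := nroot n (h n).
(* Index 0 is excluded because [x 0 = 1] by the convention for [nroot]. *)
pose L := inf [set x n | n in [set n | (0 < n)%N]].
have xE n : x n = c n * nroot n (g n) by rewrite /x nrootM ?exprn_ge0.
have hasinf : has_inf [set x n | n in [set n | (0 < n)%N]].
  by split; [exists (x 1%N); exists 1%N | exists 0 => _ [n _ <-]; exact: nroot_ge0].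
have L0 : 0 <= L.
  by apply: lb_le_inf; [exact: hasinf.1 | move=> _ [n _ <-]; exact: nroot_ge0].
have Lx n : (0 < n)%N -> L <= x n.
  by move=> n0; apply: ge_inf; [exact: hasinf.2 | exists n].
(* The correction [c n] tends to 1, so dividing it out of [x n] preserves the limit. *)
suff xL : x @ \oo --> L.
  apply/cvg_ex; exists (1^-1 * L).
  have : (fun n => (c n)^-1 * x n) @ \oo --> 1^-1 * L.
    by apply: cvgM => //; apply: cvgV => //; exact: oner_neq0.
  apply: cvg_trans; apply: near_eq_cvg; apply: nearW => n /=.
  by rewrite xE mulKf // gt_eqF // powR_gt0 // exprn_gt0.
apply/cvgrPdist_lt => e e0.
have [_ [n /= n0 <-] xn] :
    exists2 y, [set x n | n in [set n | (0 < n)%N]] y & y < L + e / 2.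
  by apply: inf_adherent => //; rewrite divr_gt0.
pose y := L + e / 2; have y0 : 0 < y by rewrite ltr_wpDl ?divr_gt0.
have hny : h n <= y ^+ n.
  by rewrite -(@exprn_nroot R n (h n)) // lerXn2r ?nnegrE ?nroot_ge0 ?ltW.
(* [D] absorbs the remainder block: [C * h r <= D * y ^+ r] for all [r < n]. *)
pose D := C * (\sum_(r < n) h r / y ^+ r) + 1.
have S0 : 0 <= \sum_(r < n) h r / y ^+ r.
  by apply: sumr_ge0 => r _; apply: divr_ge0 => //; rewrite exprn_ge0 // ltW.
have D0 : 0 < D by rewrite ltr_wpDl // mulr_ge0 // ltW.
have gN N : g N <= D * y ^+ N.
  rewrite {1 2}(divn_eq N n); set q := (N %/ n)%N; set r := (N %% n)%N.
  have rn : (r < n)%N by rewrite ltn_mod.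
  apply: le_trans (hg n q r) _.
  have -> : D * y ^+ (q * n + r) = (y ^+ n) ^+ q * (D * y ^+ r).
    by rewrite exprD mulnC exprM; ring.
  rewrite -/(h n) -/(h r) [C * _]mulrC -mulrA; apply: ler_pM.
  - by rewrite exprn_ge0.
  - by rewrite mulr_ge0 // ltW.
  - by rewrite lerXn2r ?nnegrE ?exprn_ge0 // ltW.
  rewrite -ler_pdivrMr ?exprn_gt0 // -mulrA.
  apply: (@le_trans _ _ (C * (\sum_(r < n) h r / y ^+ r))); last by rewrite lerDl.
  rewrite ler_pM2l // (bigD1 (Ordinal rn)) //= lerDl.
  by apply: sumr_ge0 => i _; apply: divr_ge0 => //; rewrite exprn_ge0 // ltW.
(* This sequence bounds [x N] by [gN], and its limit [y] lies strictly below [L + e]. *)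
have ub : (fun N => c N * (nroot N D * y)) @ \oo --> y.
  rewrite -[X in _ --> X]mul1r -[X in _ * X]mul1r.
  by apply: cvgM => //; apply: cvgM; [exact: cvg_nroot_cst | exact: cvg_cst].
have yLe : y < L + e by rewrite ltrD2l gtr_pMr // invf_lt1 // ltr1n.
near=> N.
have N0 : (0 < N)%N by near: N; exact: nbhs_infty_gt.
rewrite distrC ger0_norm ?subr_ge0 ?Lx // ltrBlDl.
have : c N * (nroot N D * y) < L + e by near: N; exact: cvgr_lt ub _ yLe.
apply: le_lt_trans.
rewrite xE ler_wpM2l ?nroot_ge0 //.
have -> : nroot N D * y = nroot N (D * y ^+ N).
  by rewrite nrootM ?nroot_exprn ?exprn_ge0 ?ltW.
exact: ler_nroot.
Unshelve. all: end_near. Qed.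

(** * Submultiplicative functionals and their regularization *)

(* What is needed from an adequate functional; unlike adequacy, this also holds
   for the (non-asymptotic) tensor rank. *)
Record submul (R : realType) (G : tensor R -> R) : Prop := Submul {
  submul_ge0 : forall t, 0 <= G t;
  submul_mono : forall s t, tle s t -> G s <= G t;
  submul_kron : forall s t, G (kron s t) <= G s * G t;
  submul_unit2 : forall t, G (kron (unit_tensor R 2) t) <= 2 * G t;
  submul_unit0 : G (unit_tensor R 0) = 0 }.

Lemma adequate_submul_functional (R : realType) (F : tensor R -> R) :
  adequate F -> submul F.
Proof.
move=> aF; split.
- exact: adequate_ge0 aF.
- exact: adequate_mono aF.
- exact: adequate_submul aF.
- by move=> t; rewrite (adequate_unit aF).
apply/eqP; rewrite eq_le (adequate_ge0 aF) andbT.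
(* Scaling with [r = 0] makes [F] vanish on [<0> (x) <0>], of which [<0>] is a restriction since all
   index sets are empty. *)
have := adequate_unit aF 0 (unit_tensor R 0); rewrite mul0r => <-.
apply: (adequate_mono aF).
by apply: (@tle_reindex R (kron (unit_tensor R 0) (unit_tensor R 0))
  (unit_tensor R 0)
  (fun i => (i, i)) (fun i => (i, i)) (fun i => (i, i))) => -[].
Qed.

Lemma rank_submul_functional (R : realType) :
  submul (fun t : tensor R => (rank t)%:R : R).
Proof.
split=> [t|s t st|s t|t|].
- by [].
- by rewrite ler_nat rank_mono.
- by rewrite -natrM ler_nat rank_submul.
- rewrite -natrM ler_nat; apply: leq_trans (rank_submul _ _) _.
  by rewrite leq_mul2r rank_unit_le orbT.
- by apply/eqP; rewrite pnatr_eq0 -leqn0; exact: rank_unit_le.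
Qed.

(** The factor [G(<1>)] comes from the base [<1>] of the iteration; a [submul] functional is not
    normalized there. *)
Lemma submul_tpow (R : realType) (G : tensor R -> R) (t : tensor R) n :
  submul G -> G (tpow t n) <= G t ^+ n * G (unit_tensor R 1).
Proof.
move=> sG; elim: n => [|n IH]; first by rewrite expr0 mul1r.
rewrite exprS -mulrA; apply: le_trans (submul_kron sG _ _) _.
by rewrite ler_wpM2l // (submul_ge0 sG).
Qed.

Lemma submul_unit2_pow (R : realType) (G : tensor R -> R) (t : tensor R) n :
  submul G ->
  G (kron (tpow (unit_tensor R 2) n) t) <= 2 ^+ n * G (unit_tensor R 1) * G t.
Proof.
move=> sG; apply: le_trans (submul_kron sG _ _) _.
rewrite ler_wpM2r ?(submul_ge0 sG) //.
elim: n => [|n IH]; first by rewrite expr0 mul1r.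
rewrite exprS -mulrA; apply: le_trans (submul_unit2 sG _) _.
by rewrite ler_wpM2l.
Qed.

(** Shows that the [limn] defining [asym] is a genuine limit and not a default value. *)
Lemma cvg_asym (R : realType) (G : tensor R -> R) (t : tensor R) :
  submul G ->
  (fun n => nroot n (G (tpow t n))) @ \oo --> asym G t.
Proof.
move=> sG.
apply: (@fekete R (fun n => G (tpow t n)) (fun=> 0%N) (G (unit_tensor R 1) + 1)).
- by rewrite ltr_wpDl ?(submul_ge0 sG).
- by move=> n; exact: submul_ge0 sG _.
- exact: sublinear0.
move=> n q r; rewrite expr0 !mul1r.
apply: le_trans (submul_mono sG (tpowD_tle _ _ _)) _.
apply: le_trans (submul_kron sG _ _) _.
rewrite ler_wpM2r ?(submul_ge0 sG) //.
apply: (@le_trans _ _ (G (unit_tensor R 1) * G (tpow t n) ^+ q)); last first.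
  by rewrite ler_wpM2r ?exprn_ge0 ?(submul_ge0 sG) ?lerDl.
elim: q => [|q IH]; first by rewrite mulr1.
rewrite mulSn; apply: le_trans (submul_mono sG (tpowD_tle _ _ _)) _.
apply: le_trans (submul_kron sG _ _) _.
by rewrite exprS mulrCA ler_wpM2l // (submul_ge0 sG).
Qed.

(** Take m-th roots and let [m] grow: [2^(mK) C] becomes [2^K C^(1/m)] with [C^(1/m)] tending to 1,
    while the m-th root of [G(T_(mn))] is the n-th power of the term of index [mn] in the sequence
    converging to [L]. *)
Lemma asym_bounds (R : realType) (G : tensor R -> R) (T : nat -> tensor R)
    (C L : R) (K n : nat) :
  submul G -> (0 < n)%N -> 0 < C ->
  (fun N => nroot N (G (T N))) @ \oo --> L ->
  (forall m, (0 < m)%N -> G (tpow (T n) m) <= 2 ^+ (m * K) * C * G (T (m * n)%N)) ->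
  (forall m, (0 < m)%N -> G (T (m * n)%N) <= 2 ^+ (m * K) * C * G (tpow (T n) m)) ->
  asym G (T n) <= 2 ^+ K * L ^+ n /\ L ^+ n <= 2 ^+ K * asym G (T n).
Proof.
move=> sG n0 C0 TL h1 h2.
have root m x : (0 < m)%N -> 0 <= x ->
    nroot m (2 ^+ (m * K) * C * x) = 2 ^+ K * (nroot m C * nroot m x).
  move=> m0 x0; have C_ge0 := ltW C0.
  by rewrite -mulrA !nrootM ?exprn_ge0 ?mulr_ge0 // mulnC exprM nroot_exprn ?exprn_ge0.
have scale (u : nat -> R) (l : R) : u @ \oo --> l ->
    (fun m => 2 ^+ K * (nroot m C * u m)) @ \oo --> 2 ^+ K * l.
  move=> ul; apply: cvgM; first exact: cvg_cst.
  by rewrite -[X in _ --> X]mul1r; apply: cvgM => //; exact: cvg_nroot_cst.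
have g0 := submul_ge0 sG.
have GL : (fun m => nroot m (G (T (m * n)%N))) @ \oo --> L ^+ n.
  apply: (@cvg_trans _ ((fun m => nroot (m * n) (G (T (m * n)%N)) ^+ n) @ \oo)).
    apply: near_eq_cvg; near=> m; rewrite [RHS](@nroot_exprM _ n) //.
    by near: m; exact: nbhs_infty_gt.
  apply: (@continuous_cvg _ _ _ _ _ _ (fun x : R => x ^+ n)).
    exact: exprn_continuous.
  exact: cvg_comp (cvg_mulnr _ n0) TL.
have Ga := @cvg_asym R G (T n) sG.
split; [have GG := scale _ _ GL | have GG := scale _ _ Ga].
  rewrite -(cvg_lim _ Ga) // -(cvg_lim _ GG) //; apply: ler_lim.
  - by apply/cvg_ex; exists (asym G (T n)).
  - by apply/cvg_ex; exists (2 ^+ K * L ^+ n).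
  near=> m; have m0 : (0 < m)%N by near: m; exact: nbhs_infty_gt.
  by rewrite /= -root //; apply: ler_nroot => //; exact: h1.
rewrite -(cvg_lim _ GL) // -(cvg_lim _ GG) //; apply: ler_lim.
- by apply/cvg_ex; exists (L ^+ n).
- by apply/cvg_ex; exists (2 ^+ K * asym G (T n)).
near=> m; have m0 : (0 < m)%N by near: m; exact: nbhs_infty_gt.
by rewrite /= -root //; apply: ler_nroot => //; exact: h2.
Unshelve. all: end_near. Qed.

(** * Limits along approximately geometric sequences *)

Lemma approx_geometric_cvg (R : realType) (T : nat -> tensor R) (G : tensor R -> R) :
  approx_geometric T -> submul G ->
  exists L : R,
    (fun n => nroot n (G (T n))) @ \oo --> L /\
    (fun n => nroot n (asym G (T n))) @ \oo --> L.
Proof.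
move=> + sG; have g0 := submul_ge0 sG.
have G1 : 0 < G (unit_tensor R 1) + 1 by rewrite ltr_wpDl.
set C := G (unit_tensor R 1) + 1 in G1.
have G1C : G (unit_tensor R 1) <= C by rewrite lerDl.
case=> [[k [_ hk]]|[_ [k [ksub hk]]]].
  (* Degenerate case: for [n > 0], [T_n] is a restriction of a multiple of [<0>], so both limits are
     0. *)
  have GT n : (0 < n)%N -> G (T n) = 0.
    move=> n0; apply/eqP; rewrite eq_le g0 andbT.
    have [+ _] := hk n; rewrite -(prednK n0) => h.
    apply: le_trans (submul_mono sG h) _.
    apply: le_trans (submul_kron sG _ _) _.
    by rewrite (submul_unit0 sG) mulr0.
  have GA n : (0 < n)%N -> asym G (T n) = 0.
    move=> n0; apply: cvg_lim => //; apply: (@cvg_trans _ ((fun=> 0 : R) @ \oo)).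
      apply: near_eq_cvg; near=> m.
      have m0 : (0 < m)%N by near: m; exact: nbhs_infty_gt.
      rewrite (_ : G _ = 0) ?nroot0 //; apply/eqP; rewrite eq_le g0 andbT.
      apply: le_trans (submul_tpow _ _ sG) _.
      by rewrite GT // expr0n gtn_eqF // mul0r.
    exact: cvg_cst.
  exists 0; split; apply: (@cvg_trans _ ((fun=> 0 : R) @ \oo));
    try exact: cvg_cst; apply: near_eq_cvg; near=> n;
    (have n0 : (0 < n)%N by near: n; exact: nbhs_infty_gt);
    by rewrite ?GT ?GA ?nroot0.
have G1_ge0 : 0 <= G (unit_tensor R 1) := g0 _.
have hpow n m : (0 < m)%N ->
    let E := tpow (unit_tensor R 2) (m * k n) in
    tle (tpow (T n) m) (kron E (T (m * n)%N)) /\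
    tle (T (m * n)%N) (kron E (tpow (T n) m)).
  by move=> m0; have := hk m (fun=> n) m0; rewrite big_const_ord !sum_nat_const card_ord.
have ler_unit1 n t : 2 ^+ n * G (unit_tensor R 1) * G t <= 2 ^+ n * C * G t.
  by rewrite ler_wpM2r // ler_wpM2l ?exprn_ge0.
have : cvgn (fun n => nroot n (G (T n))).
  apply: (@fekete R (fun n => G (T n)) k (C * C)) => // [|n q r]; first exact: mulr_gt0.
  (* One index [r] followed by [q] copies of [n]: the family is nonempty even for [q = 0], and its
     product is [T_r (x) T_n^(x)q]. *)
  have := hk q.+1 (fun i => if i == ord0 then r else n) isT.
  rewrite !big_ord_recl /= big_const_ord !sum_nat_const card_ord => -[_].
  rewrite [(r + _)%N]addnC => /(submul_mono sG) /le_trans; apply.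
  apply: le_trans (submul_unit2_pow _ _ sG) _.
  apply: le_trans (ler_unit1 _ _) _.
  (* One factor [C] pays for the power of [<2>], the other for the trailing [<1>] in the tensor
     power of [T_n]. *)
  have -> : C * C * (2 ^+ k n * G (T n)) ^+ q * (2 ^+ k r * G (T r)) =
      2 ^+ (k r + q * k n) * C * (G (T r) * (G (T n) ^+ q * C)).
    by rewrite exprD mulnC exprM exprMn; ring.
  rewrite ler_wpM2l ?mulr_ge0 ?exprn_ge0 ?(ltW G1) //.
  apply: le_trans (submul_kron sG _ _) _; rewrite ler_wpM2l //.
  apply: le_trans (submul_tpow _ _ sG) _.
  by rewrite ler_wpM2l ?exprn_ge0.
move=> /cvg_ex [L TL]; exists L; split => //.
have L0 : 0 <= L.
  rewrite -(cvg_lim _ TL) //; apply: limr_ge; first by apply/cvg_ex; exists L.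
  by apply: nearW => n; exact: nroot_ge0.
have asym_ge0 t : 0 <= asym G t.
  rewrite -(cvg_lim _ (@cvg_asym R G t sG)) //; apply: limr_ge.
    by apply/cvg_ex; exists (asym G t); exact: cvg_asym.
  by apply: nearW => n; exact: nroot_ge0.
have c1 := cvg_nroot_exprn (ltr0n R 2) ksub.
(* Both bounds are n-th roots of [2^(-k_n) L^n] and [2^(k_n) L^n]. *)
apply: (@squeeze_cvgr _ _ _ _ (fun n => (nroot n (2 ^+ k n))^-1 * L)
  (fun n => nroot n (2 ^+ k n) * L)).
- near=> n; have n0 : (0 < n)%N by near: n; exact: nbhs_infty_gt.
  have [ub lb] : asym G (T n) <= 2 ^+ k n * L ^+ n /\
      L ^+ n <= 2 ^+ k n * asym G (T n).
    apply: (asym_bounds sG n0 G1 TL) => m m0; have [h1 h2] := hpow n m m0.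
      apply: le_trans (submul_mono sG h1) _.
      exact: le_trans (submul_unit2_pow _ _ sG) (ler_unit1 _ _).
    apply: le_trans (submul_mono sG h2) _.
    exact: le_trans (submul_unit2_pow _ _ sG) (ler_unit1 _ _).
  rewrite ler_pdivrMl ?powR_gt0 ?exprn_gt0 // -nrootM ?exprn_ge0 //.
  rewrite -[X in X <= _ ](@nroot_exprn R n L) // ler_nroot ?exprn_ge0 //=.
  rewrite -[X in _ * X](@nroot_exprn R n L) // -nrootM ?exprn_ge0 //.
  by rewrite ler_nroot.
- rewrite -[X in _ --> X]mul1r; apply: cvgM; last exact: cvg_cst.
  by rewrite -[X in _ --> X]invr1; apply: cvgV => //; exact: oner_neq0.
- by rewrite -[X in _ --> X]mul1r; apply: cvgM => //; exact: cvg_cst.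
Unshelve. all: end_near. Qed.

Theorem proposition5p14 (R : realType) (T : nat -> tensor R) :
  approx_geometric T ->
  almost_exponential T /\
  forall F : tensor R -> R, adequate F ->
    exists L : R,
      (fun n : nat => nroot n (F (T n))) @ \oo --> L /\
      (fun n : nat => nroot n (asym F (T n))) @ \oo --> L.
Proof.
move=> hT.
have hF (F : tensor R -> R) (aF : adequate F) :=
  approx_geometric_cvg hT (adequate_submul_functional aF).
split; last exact: hF.
split.
  (* [asym_rank] unfolds to [asym] of the rank functional. *)
  have [L [_ h]] := approx_geometric_cvg hT (rank_submul_functional R).
  by apply/cvg_ex; exists L.
move=> F /hF [L [h _]].
by apply: (@cvg_seq_bounded _ R^o); apply/cvg_ex; exists L.
Qed.
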